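(* Let $G$ be a left brace, let $\{G_i\}_{i\in I}$ be the orbits of $G$ under the action $\lambda$ of $(G,\cdot)$ on $G$, and choose an element $x_i\in G_i$ for each $i\in I$. Let $I_1,I_2$ be subsets of $I$ such that each of $X_1=\bigcup_{i\in I_1}G_i$ and $X_2=\bigcup_{j\in I_2}G_j$ generates the additive group $(G,+)$. For each $i\in I_1$, let $\{K_{i,k}\}_{k\in A_i}$ be a non-empty family of subgroups of the stabilizer $\operatorname{St}_G(x_i)=\{g\in G\mid\lambda_g(x_i)=x_i\}$ such that $\bigcap_{i\in I_1}\bigcap_{k\in A_i}\operatorname{core}(K_{i,k})=\{1\}$. For each $j\in I_2$, let $\{L_{j,l}\}_{l\in B_j}$ be a non-empty family of subgroups of $\operatorname{St}_G(x_j)$ such that $\bigcap_{j\in I_2}\bigcap_{l\in B_j}\operatorname{core}(L_{j,l})=\{1\}$. Let $Y_1$ be the disjoint union of the left $G$-sets $G/K_{i,k}$ for $i\in I_1$, $k\in A_i$, and let $Y_2$ be the disjoint union of the left $G$-sets $G/L_{j,l}$ for $j\in I_2$, $l\in B_j$ (distinct indices give disjoint copies). Let $s_1\colon Y_1^2\to Y_1^2$ and $s_2\colon Y_2^2\to Y_2^2$ be the maps \begin{align*} s_1(g_1K_{i_1,k_1},g_2K_{i_2,k_2})&=\bigl(\lambda_{g_1}(x_{i_1})g_2K_{i_2,k_2},\ \lambda_{\lambda_{g_1}(x_{i_1})g_2}(x_{i_2})^{-1}g_1K_{i_1,k_1}\bigr),\\ s_2(g_1L_{j_1,l_1},g_2L_{j_2,l_2})&=\bigl(\lambda_{g_1}(x_{j_1})g_2L_{j_2,l_2},\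 \lambda_{\lambda_{g_1}(x_{j_1})g_2}(x_{j_2})^{-1}g_1L_{j_1,l_1}\bigr), \end{align*} where juxtaposition and inverse are taken in $(G,\cdot)$; $(Y_1,s_1)$ and $(Y_2,s_2)$ are solutions of the YBE. Then the solutions $(Y_1,s_1)$ and $(Y_2,s_2)$ are isomorphic if and only if there exist an automorphism $\psi$ of the left brace $G$, a bijective map $\alpha\colon I_1\to I_2$, a bijective map $\beta_i\colon A_i\to B_{\alpha(i)}$ for each $i\in I_1$, and an element $z_{i,k}\in G$ for each $i\in I_1$ and $k\in A_i$, such that $$\psi(x_i)=\lambda_{z_{i,k}}(x_{\alpha(i)})\quad\text{and}\quad\psi(K_{i,k})=z_{i,k}L_{\alpha(i),\beta_i(k)}z_{i,k}^{-1}$$ for all $i\in I_1$ and $k\in A_i$.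
   Context: A left brace is a set $B$ with two binary operations $+$ and $\cdot$ such that $(B,+)$ is an abelian group, $(B,\cdot)$ is a group, and $x\cdot(y+z)+x=x\cdot y+x\cdot z$ for all $x,y,z\in B$. A morphism of left braces is a map preserving both $+$ and $\cdot$; an automorphism is a bijective morphism from $B$ to itself. For $x\in B$ define $\lambda_x\colon B\to B$ by $\lambda_x(y)=xy-x$. Each $\lambda_x$ is an automorphism of $(B,+)$, and $x\mapsto\lambda_x$ is a group morphism $\lambda\colon(B,\cdot)\to\operatorname{Aut}(B,+)$; this is the action $\lambda$ of $(B,\cdot)$ on $B$. Subgroups, cosets and conjugation are taken in $(G,\cdot)$. For a subgroup $K$ of $(G,\cdot)$, $\operatorname{core}(K)=\bigcap_{g\in G}gKg^{-1}$. A solution of the YBE is a pair $(X,r)$, with $X$ a set and $r\colon X\times X\to X\times X$, $r(x,y)=(\sigma_x(y),\gamma_y(x))$, a map satisfying $r_{12}r_{23}r_{12}=r_{23}r_{12}r_{23}$ on $X\times X\times X$ (where $r_{ij}$ acts as $r$ on components $i,j$ and as the identity on the remaining one), which is involutive ($r^2=\mathrm{id}$) and non-degenerate (all maps $\sigma_x$ and $\gamma_x$ are bijections of $X$). An isomorphism of solutions $(X,r)\to(Y,s)$ is a bijection $F\colon X\to Y$ with $s\circ(F\times F)=(F\times F)\circ r$. *)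

(* Defs.v *)
From HB Require Import structures.
From mathcomp Require Import all_boot all_algebra.
From mathcomp Require Import boolp classical_sets functions.

Set Implicit Arguments.
Unset Strict Implicit.
Unset Printing Implicit Defensive.

Import GRing.Theory.
Local Open Scope classical_set_scope.
Local Open Scope ring_scope.
Local Open Scope group_scope.

(* Products, inverses and units in group_scope are those of the               *)
(* multiplicative group of a left brace, sums and opposites those of its      *)
(* additive group. Operands of + and - are parsed in ring_scope, hence the    *)
(* explicit %g. The carrier is a choiceType, as for all MathComp algebraic    *)
(* structures; this is no restriction under the classical axioms of boolp.    *)

HB.mixin Record Zmodule_Group_isLeftBrace B of GRing.Zmodule B & Group B := {
  braceD : forall x y z : B, (x * (y + z))%g + x = (x * y)%g + (x * z)%g
}.

#[short(type="leftBraceType")]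
HB.structure Definition LeftBrace :=
  {B of Zmodule_Group_isLeftBrace B & GRing.Zmodule B & Group B}.

Definition brace_automorphism (B : leftBraceType) (psi : B -> B) : Prop :=
  [/\ {morph psi : x y / x + y}, {morph psi : x y / x * y} & bijective psi].

Definition lambda (B : leftBraceType) (x y : B) : B := (x * y)%g - x.

Definition lambda_orbit (B : leftBraceType) (y : B) : set B :=
  [set lambda g y | g in [set: B]].

Definition lambda_stab (B : leftBraceType) (y : B) : set B :=
  [set g | lambda g y = y].

Definition add_generates (V : zmodType) (X : set V) : Prop :=
  smallest (fun H : set V => zmod_closed (mem H)) X = [set: V].

Definition is_subgroup (G : groupType) (K : set G) : Prop :=
  group_closed (mem K).

Definition conj_set (G : groupType) (z : G) (K : set G) : set G :=
  [set z * k * z^-1 | k in K].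

Definition core (G : groupType) (K : set G) : set G :=
  \bigcap_(g in [set: G]) conj_set g K.

Definition left_coset (G : groupType) (g : G) (K : set G) : set G :=
  [set g * k | k in K].

(* The quotient G / K, used as a type through the coercion set_type. *)
Definition left_cosets (G : groupType) (K : set G) : set (set G) :=
  range (fun g : G => left_coset g K).

Section Solutions.
Variable X : Type.
Implicit Type r : X * X -> X * X.

Definition r12 r (t : X * X * X) : X * X * X :=
  let: (x, y, z) := t in let: (x', y') := r (x, y) in (x', y', z).

Definition r23 r (t : X * X * X) : X * X * X :=
  let: (x, y, z) := t in let: (y', z') := r (y, z) in (x, y', z').

Definition involutive_solution r : Prop :=
  [/\ r12 r \o r23 r \o r12 r =1 r23 r \o r12 r \o r23 r,
      r \o r =1 id,
      forall x, bijective (fun y => (r (x, y)).1)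
    & forall y, bijective (fun x => (r (x, y)).2)].

End Solutions.

Record solution : Type := Solution {
  sol_carrier :> Type;
  sol_map : sol_carrier * sol_carrier -> sol_carrier * sol_carrier;
  sol_mapP : involutive_solution sol_map
}.

Definition pair_map (X Y : Type) (F : X -> Y) (p : X * X) : Y * Y :=
  (F p.1, F p.2).

Definition solutions_isomorphic (S T : solution) : Prop :=
  exists2 F : S -> T, bijective F &
    forall p, sol_map (pair_map F p) = pair_map F (sol_map p).

Section BraceTheory.
Variable B : leftBraceType.
Implicit Types a b c x : B.

Lemma brace_mul0 x : x * 0 = x.
Proof. by have := braceD x 0 0; rewrite addr0 => /addrI. Qed.

Lemma brace_zero : 0 = 1 :> B.
Proof. by rewrite -[LHS]mul1g brace_mul0. Qed.

Lemma lambdaE x y : x * y = x + lambda x y.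
Proof. by rewrite /lambda addrC subrK. Qed.

Lemma lambdaD x y z : lambda x (y + z) = lambda x y + lambda x z.
Proof.
apply: (addIr x); rewrite /lambda subrK -[RHS]addrA subrK.
by apply: (addIr x); rewrite braceD -!addrA (addrCA (- x)) addNr addr0.
Qed.

Lemma lambda1 x : lambda 1 x = x.
Proof. by rewrite /lambda mul1g -brace_zero subr0. Qed.

Lemma lambdaM x y z : lambda (x * y) z = lambda x (lambda y z).
Proof.
apply: (addrI (x * y)); rewrite -lambdaE -mulgA.
by rewrite [in RHS]lambdaE -[RHS]addrA -lambdaD -lambdaE -lambdaE.
Qed.

Lemma lambdaK x : cancel (lambda x) (lambda x^-1).
Proof. by move=> y; rewrite -lambdaM mulVg lambda1. Qed.

Lemma lambdaVK x : cancel (lambda x^-1) (lambda x).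
Proof. by move=> y; rewrite -lambdaM mulgV lambda1. Qed.

(* A left G-set Y with an equivariant map q from Y to G carries a solution.   *)
Section ActionSolution.
Variables (Y : Type) (act : B -> Y -> Y) (q : Y -> B).
Hypothesis act1 : forall y, act 1 y = y.
Hypothesis actM : forall g h y, act (g * h) y = act g (act h y).
Hypothesis q_act : forall g y, q (act g y) = lambda g (q y).

Definition action_map (p : Y * Y) : Y * Y :=
  (act (q p.1) p.2, act (q (act (q p.1) p.2))^-1 p.1).

Lemma action_solution : involutive_solution action_map.
Proof.
have swap a b : lambda a b * lambda (lambda a b)^-1 a = a * b.
  by rewrite !lambdaE lambdaVK addrC.
split.
- move=> [[y1 y2] y3]; rewrite /action_map /= !q_act -!actM.
  set a := q y1; set b := q y2; set c := q y3.
  congr (_, _, _).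
  + by rewrite swap.
  + congr act.
    rewrite -!lambdaM swap lambdaM.
    set d := lambda a (lambda b c).
    apply: (mulgI d); rewrite !mulgA mulgV mul1g.
    by rewrite /d swap mulgK.
  + congr act; rewrite -!invgM; congr (_^-1).
    rewrite -!lambdaM.
    rewrite [LHS]lambdaE -lambdaM swap.
    set d := lambda (a * b) c.
    have -> : lambda d^-1 a * (lambda b c)^-1 = d^-1 * a.
      apply: (mulgI d); rewrite !mulgA mulgV mul1g.
      by rewrite /d lambdaM swap mulgK.
    by rewrite lambdaE -lambdaM mulgA mulgV mul1g addrC.
- move=> [y1 y2]; rewrite /action_map /= !q_act -!actM mulgV act1.
  by rewrite lambdaVK mulVg act1.
- move=> y1; exists (act (q y1)^-1) => y2; rewrite /action_map /= -actM.
    by rewrite mulVg act1.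
  by rewrite mulgV act1.
- move=> y2; rewrite /action_map /=; set c := q y2.
  exists (fun w => act (lambda (lambda c (q w)^-1)^-1 c) w) => y;
    rewrite /= !q_act -actM -/c.
  + set a := q y.
    suff -> : lambda c (lambda (lambda a c)^-1 a)^-1 = a^-1.
      by rewrite invgK mulgV act1.
    apply: (addrI c); rewrite -lambdaE.
    have -> : c + (a^-1)%g = a^-1 * lambda a c by rewrite lambdaE lambdaK addrC.
    apply: (mulIg (lambda (lambda a c)^-1 a)).
    by rewrite -!mulgA mulVg mulg1 swap mulKg.
  + set v := q y; set a := (lambda c v^-1)^-1.
    suff -> : lambda (lambda a c) v = a by rewrite mulVg act1.
    apply: (addrI (lambda a c)); rewrite -lambdaE.
    rewrite [RHS]addrC -lambdaE; apply: (mulgI a^-1).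
    rewrite mulKg mulgA (lambdaE a^-1) lambdaK /a invgK addrC -lambdaE.
    by rewrite -mulgA mulVg mulg1.
Qed.

End ActionSolution.
End BraceTheory.

Section CosetSolution.
Variables (G : leftBraceType) (J : Type) (A : J -> Type).
Variables (x : J -> G) (K : forall j, A j -> set G).

Definition coset_union : Type := {j : J & {k : A j & left_cosets (K k)}}.

Definition coset_pt (j : J) (k : A j) (g : G) : coset_union :=
  existT _ j (existT _ k (exist _ (left_coset g (K k)) (mem_set (imageT _ g)))).

Lemma left_coset_repr (j : J) (k : A j) (C : left_cosets (K k)) :
  exists g, left_coset g (K k) = val C.
Proof. by have [g _ gC] := set_mem (valP C); exists g. Qed.

Definition repr_coset (j : J) (k : A j) (C : left_cosets (K k)) : G :=
  projT1 (cid (left_coset_repr C)).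

(* The two cosets are written as g1 K and g2 K by choosing representatives;   *)
(* coset_mapE below shows that the choice is irrelevant.                      *)
Definition coset_map (p : coset_union * coset_union) :
    coset_union * coset_union :=
  let: (existT j1 (existT k1 C1), existT j2 (existT k2 C2)) := p in
  let g1 := repr_coset C1 in
  let g2 := repr_coset C2 in
  (coset_pt k2 (lambda g1 (x j1) * g2),
   coset_pt k1 ((lambda (lambda g1 (x j1) * g2) (x j2))^-1 * g1)).

Hypothesis K_subgroup : forall j (k : A j), is_subgroup (K k).
Hypothesis K_stab : forall j (k : A j), K k `<=` lambda_stab (x j).

Lemma coset_ptP (y : coset_union) :
  exists j (k : A j) g, y = coset_pt k g.
Proof.
case: y => j [k C]; have [g gC] := left_coset_repr C.
exists j, k, g; congr existT; congr existT.
by apply: val_inj; rewrite /= gC.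
Qed.

Lemma eq_coset_pt (j : J) (k : A j) g h :
  K k (g^-1 * h) -> coset_pt k g = coset_pt k h.
Proof.
move=> Kgh; congr existT; congr existT; apply: val_inj => /=.
have [K1 KF] := K_subgroup k.
have Kop a b : K k a -> K k b -> K k (a * b^-1).
  by move=> Ka Kb; have := KF a b (mem_set Ka) (mem_set Kb); move/set_mem.
have KV a : K k a -> K k a^-1.
  by move=> Ka; rewrite -[a^-1]mul1g; apply: Kop => //; exact: (set_mem K1).
have KM a b : K k a -> K k b -> K k (a * b).
  by move=> Ka /KV Kb; rewrite -[b]invgK; apply: Kop.
apply/seteqP; split=> _ [u Ku <-].
  exists ((g^-1 * h)^-1 * u); first by apply: KM => //; apply: KV.
  by rewrite invgM invgK !mulgA mulgV mul1g.
exists (g^-1 * h * u); first exact: KM.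
by rewrite !mulgA mulgV mul1g.
Qed.

Lemma coset_pt_repr (j : J) (k : A j) g (C := projT2 (projT2 (coset_pt k g))) :
  K k (g^-1 * repr_coset C).
Proof.
rewrite /repr_coset; case: cid => h /= /seteqP[hg _].
have [u Ku hu] : left_coset g (K k) h.
  apply: hg; exists 1; last by rewrite mulg1.
  by have [K1 _] := K_subgroup k; exact: (set_mem K1).
by rewrite -hu mulKg.
Qed.

Lemma coset_mapE (j1 j2 : J) (k1 : A j1) (k2 : A j2) (g1 g2 : G) :
  coset_map (coset_pt k1 g1, coset_pt k2 g2) =
  (coset_pt k2 (lambda g1 (x j1) * g2),
   coset_pt k1 ((lambda (lambda g1 (x j1) * g2) (x j2))^-1 * g1)).
Proof.
rewrite /coset_map /=.
have /= := coset_pt_repr k1 g1; have /= := coset_pt_repr k2 g2.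
set h2 := repr_coset _ => Kh2; set h1 := repr_coset _ => Kh1.
have e1 : lambda h1 (x j1) = lambda g1 (x j1).
  by rewrite -{1}[h1](mulVKg g1) lambdaM (K_stab Kh1).
rewrite e1; set a := lambda g1 (x j1).
have e2 : lambda (a * h2) (x j2) = lambda (a * g2) (x j2).
  by rewrite -{1}[h2](mulVKg g2) mulgA [LHS]lambdaM (K_stab Kh2).
rewrite e2; congr (_, _); apply/esym/eq_coset_pt.
  by rewrite invgM -mulgA mulKg.
by rewrite invgM -mulgA mulKg.
Qed.

Lemma coset_mapP : involutive_solution coset_map.
Proof.
pose act (h : G) (y : coset_union) : coset_union :=
  let: existT j (existT k C) := y in coset_pt k (h * repr_coset C).
pose q (y : coset_union) : G :=
  let: existT j (existT k C) := y in lambda (repr_coset C) (x j).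
have actE h j (k : A j) g : act h (coset_pt k g) = coset_pt k (h * g).
  apply/esym/eq_coset_pt; rewrite invgM -mulgA mulKg.
  exact: (coset_pt_repr k g).
have qE j (k : A j) g : q (coset_pt k g) = lambda g (x j).
  rewrite /q /=; have /= := coset_pt_repr k g.
  set h := repr_coset _ => Kh.
  by rewrite -{1}[h](mulVKg g) lambdaM (K_stab Kh).
clearbody act q.
have -> : coset_map = action_map act q.
  apply/funext => -[y1 y2].
  have [j1 [k1 [g1 ->]]] := coset_ptP y1.
  have [j2 [k2 [g2 ->]]] := coset_ptP y2.
  by rewrite coset_mapE /action_map /= !(qE, actE).
apply: action_solution => [y|g h y|g y].
- by have [j [k [g ->]]] := coset_ptP y; rewrite actE mul1g.
- by have [j [k [u ->]]] := coset_ptP y; rewrite !actE mulgA.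
- by have [j [k [u ->]]] := coset_ptP y; rewrite actE !qE lambdaM.
Qed.

Definition coset_solution : solution := Solution coset_mapP.

End CosetSolution.

(* Main.v *)
(* Y_1 is a G-set with an equivariant map q(gK_{i,k}) = lambda_g(x_i) to (G,+),
   and s_1 is determined by the permutations y -> q(w) y.  The core condition
   says that the action is faithful, and the generation condition says that the
   values of q generate (G,.) as well as (G,+).  An isomorphism F of solutions
   conjugates the permutation of q(w) to that of q(F w), hence induces an
   automorphism psi of (G,.) with F(g y) = psi(g) F(y) and psi o q = q o F;
   since g + q(w) = g q(g^-1 w), psi is also additive.  Now F maps G-orbits to
   G-orbits, and comparing the images of the base points K_{i,k} and their
   stabilizers yields alpha, beta and z.  Conversely such data define
   F(g K_{i,k}) = psi(g) z_{i,k} L_{alpha(i),beta_i(k)}. *)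
Require Import Defs.
From mathcomp Require Import all_boot all_algebra.
From mathcomp Require Import boolp classical_sets functions.

Set Implicit Arguments.
Unset Strict Implicit.
Unset Printing Implicit Defensive.
Import GRing.Theory.
Local Open Scope classical_set_scope.
Local Open Scope ring_scope.
Local Open Scope group_scope.

(** Equality proofs are irrelevant, so transport along any proof that the first components agree is
    trivial. This strips the tags [j] and [k] off an equality of points of a coset union. *)
Lemma existT_inj2 (T : Type) (P : T -> Type) (t : T) (a b : P t) :
  existT P t a = existT P t b -> a = b.
Proof.
suff H (u v : {t & P t}) (e : u = v) (et : projT1 u = projT1 v) :
    eq_rect _ P (projT2 u) _ et = projT2 v by move/H => /(_ erefl).
by case: v / e et => et; rewrite (Prop_irrelevance et erefl).
Qed.

(** * Induction over an additive generating set *)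

Section AdditiveGeneration.

Lemma add_generates_ind (V : zmodType) (X : set V) (P : V -> Prop) :
  add_generates X -> (forall a, X a -> P a) -> P 0%R ->
  (forall a b, P a -> P b -> P (a - b)%R) -> forall a, P a.
Proof.
move=> gX XP P0 PB a; have : [set: V] a by [].
rewrite -gX; apply; split=> //; split; first exact: mem_set.
by move=> b c /set_mem Pb /set_mem Pc; apply/mem_set/PB.
Qed.

Variable G : leftBraceType.
Implicit Types (X : set G) (P : G -> Prop) (a g h : G).

Lemma lambda0 g : lambda g 0%R = 0%R.
Proof. by apply: (addIr (lambda g 0%R)); rewrite -lambdaD !add0r. Qed.

Lemma lambdaN g a : lambda g (- a)%R = (- lambda g a)%R.
Proof. by apply: (addrI (lambda g a)); rewrite -lambdaD !addrN lambda0. Qed.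

Lemma lambdaVE g : lambda g^-1 g = (- g^-1%g)%R.
Proof.
by apply: (addrI g^-1); rewrite -lambdaE mulVg addrN brace_zero.
Qed.

Lemma lambda_mulE g a : (g + a)%R = g * lambda g^-1 a.
Proof. by rewrite lambdaE lambdaVK. Qed.

(* h + x = h * x' and h - x = h * u^-1 where x' and u are in the lambda-orbit
   of x, so the multiplicative closure of X is stable under addition of
   elements of X and of their opposites. *)
Lemma add_generates_mul_ind X P :
  add_generates X -> (forall g a, X a -> X (lambda g a)) ->
  (forall a, X a -> P a) -> P 1 ->
  (forall g h, P g -> P h -> P (g * h)) -> (forall g, P g -> P g^-1) ->
  forall g, P g.
Proof.
move=> gX Xl XP P1 PM PV.
(* Closure of [P] under subtraction is not visible directly. The additive induction therefore runs
   on [S], the elements whose translations in both directions preserve [P]; such translations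
   compose. *)
pose S a := forall h, P h -> P (h + a)%R /\ P (h - a)%R.
have Sall : forall a, S a.
  apply: (add_generates_ind gX) => [a Xa h Ph|h Ph|a b Sa Sb h Ph].
  - split; first by rewrite lambda_mulE; apply: PM => //; apply/XP/Xl.
    rewrite lambda_mulE; apply: PM => //.
    rewrite lambdaN; set y := lambda _ _; have Xy : X y by apply: Xl.
    rewrite -[(- y)%R]invgK; apply/PV/XP.
    (* By [lambdaVE] at [- y], the inverse of [- y] lies in the [lambda]-orbit of [y], hence in
       [X]. *)
    have -> : (- y)%R^-1 = lambda (- y)%R^-1 y.
        by rewrite -{3}[y]opprK lambdaN lambdaVE opprK.
    exact: Xl.
  - by rewrite oppr0 addr0.
  - rewrite opprB !addrA; split.
      by have [/Sb[]] := Sa h Ph.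
    by rewrite addrAC; have [_ /Sb[]] := Sa h Ph.
move=> g; have [+ _] := Sall g _ P1.
by rewrite -brace_zero add0r.
Qed.

End AdditiveGeneration.

(** * Isomorphisms between solutions defined by equivariant actions *)

Section ActionIsomorphisms.
Variable G : leftBraceType.

Record equivariant_action (Y : Type) (act : G -> Y -> Y) (q : Y -> G) : Prop :=
  EquivariantAction {
    eact1 : forall y, act 1 y = y;
    eactM : forall g h y, act (g * h) y = act g (act h y);
    eactq : forall g y, q (act g y) = lambda g (q y) }.

Definition faithful_action (Y : Type) (act : G -> Y -> Y) : Prop :=
  forall g, (forall y, act g y = y) -> g = 1.

Lemma faithful_inj (Y : Type) (act : G -> Y -> Y) (q : Y -> G) :
  equivariant_action act q -> faithful_action act ->
  forall g h, (forall y, act g y = act h y) -> g = h.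
Proof.
move=> [a1 aM _] fa g h gh; apply: (mulgI h^-1); rewrite mulVg.
by apply: fa => y; rewrite aM gh -aM mulVg a1.
Qed.

Section Transport.
Variables (Y Z : Type) (actY : G -> Y -> Y) (qY : Y -> G).
Variables (actZ : G -> Z -> Z) (qZ : Z -> G).
Hypotheses (eY : equivariant_action actY qY) (eZ : equivariant_action actZ qZ).
Hypothesis gY : add_generates (range qY).
Variable F : Y -> Z.
Hypothesis FE : forall y w, F (actY (qY y) w) = actZ (qZ (F y)) (F w).

(** The elements [g] admitting a partner form a subgroup of (G,.) containing the values of [qY].
    These values are stable under [lambda], so they generate multiplicatively. *)
Lemma action_transport :
  exists psi : G -> G, forall g y, F (actY g y) = actZ (psi g) (F y).
Proof.
have [Y1 YM Yq] := eY; have [Z1 ZM _] := eZ.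
suff /boolp.choice[psi psiE] : forall g, exists h, forall y,
  F (actY g y) = actZ h (F y) by exists psi.
apply: (add_generates_mul_ind (P := fun g => exists h, forall y,
    F (actY g y) = actZ h (F y)) gY).
- by move=> g _ [y _ <-]; exists (actY g y).
- by move=> _ [y _ <-]; exists (qZ (F y)) => w.
- by exists 1 => y; rewrite Y1 Z1.
- move=> g h [g' gg'] [h' hh']; exists (g' * h') => y.
  by rewrite YM gg' hh' ZM.
- move=> g [g' gg']; exists g'^-1 => y.
  by rewrite -{2}[y]Y1 -(mulgV g) YM gg' -ZM mulVg Z1.
Qed.

End Transport.

Section Isomorphism.
Variables (Y Z : Type) (actY : G -> Y -> Y) (qY : Y -> G).
Variables (actZ : G -> Z -> Z) (qZ : Z -> G).
Hypotheses (eY : equivariant_action actY qY) (eZ : equivariant_action actZ qZ).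
Hypotheses (gY : add_generates (range qY)) (gZ : add_generates (range qZ)).
Hypotheses (fY : faithful_action actY) (fZ : faithful_action actZ).
Variable F : Y -> Z.
Hypothesis bijF : bijective F.

(** Faithfulness on [Z] makes partners unique, which forces [psi] to be multiplicative and fixes it
    on the values of [qY]. The partner map of the inverse of [F] is the inverse of [psi]. *)
Lemma action_isomorphism :
  (forall p, action_map actZ qZ (pair_map F p) =
             pair_map F (action_map actY qY p)) ->
  exists psi : G -> G,
    [/\ brace_automorphism psi,
        forall g y, F (actY g y) = actZ (psi g) (F y)
      & forall y, psi (qY y) = qZ (F y)].
Proof.
move=> Fmap; have [F' FK F'K] := bijF.
have [Y1 YM Yq] := eY; have [Z1 ZM Zq] := eZ.
have Zinj := faithful_inj eZ fZ; have Yinj := faithful_inj eY fY.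
have FE y w : F (actY (qY y) w) = actZ (qZ (F y)) (F w).
  by have [] := Fmap (y, w).
have F'E y w : F' (actZ (qZ y) w) = actY (qY (F' y)) (F' w).
  by apply: (can_inj FK); rewrite FE !F'K.
have [psi psiE] := action_transport eY eZ gY FE.
have [psi' psi'E] := action_transport eZ eY gZ F'E.
have psi_q y : psi (qY y) = qZ (F y).
  by apply: Zinj => w; rewrite -[w]F'K -psiE FE.
have psiM : {morph psi : g h / g * h}.
  by move=> g h; apply: Zinj => w; rewrite -[w]F'K -psiE YM !psiE ZM.
have psi1 : psi 1 = 1 by apply: (mulgI (psi 1)); rewrite -psiM !mulg1.
have psiV g : psi g^-1 = (psi g)^-1.
  by apply: (mulgI (psi g)); rewrite -psiM !mulgV.
have psi0 : psi 0%R = 0%R by rewrite brace_zero.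
exists psi; split=> //; split=> //.
(* Induction on the right summand. The left one stays general because the difference case uses the
   hypothesis on [b] at [c - b]. *)
- move=> g a; move: a g.
  apply: (add_generates_ind gY) => [_ [y _ <-] g|g|a b Pa Pb g].
  + by rewrite lambda_mulE psiM -Yq !psi_q psiE Zq psiV -lambda_mulE.
  + by rewrite psi0 !addr0.
  + have Psub c : psi (c - b)%R = (psi c - psi b)%R.
      by apply: (addIr (psi b)); rewrite -Pb !subrK.
    by rewrite Psub addrA Psub Pa addrA.
- exists psi' => g.
    by apply: Yinj => y; rewrite -[y]FK -psi'E -psiE !FK.
  by apply: Zinj => z; rewrite -[z]F'K -psiE -psi'E !F'K.
Qed.

End Isomorphism.
End ActionIsomorphisms.

(** * The action on a disjoint union of coset spaces *)

Section CosetAction.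
Variables (G : leftBraceType) (J : Type) (A : J -> Type).
Variables (x : J -> G) (K : forall j, A j -> set G).

(** This action and [coset_q] are computed on chosen representatives. The choice is immaterial, for
    [coset_q] because [K k] fixes [x j]. *)
Definition coset_act (h : G) (y : coset_union K) : coset_union K :=
  let: existT j (existT k C) := y in coset_pt K k (h * repr_coset C).

Definition coset_q (y : coset_union K) : G :=
  let: existT j (existT k C) := y in lambda (repr_coset C) (x j).

Arguments coset_act : simpl never.
Arguments coset_q : simpl never.

Hypothesis K_subgroup : forall j (k : A j), is_subgroup (K k).
Hypothesis K_stab : forall j (k : A j), K k `<=` lambda_stab (x j).

Lemma coset_actE h j (k : A j) g :
  coset_act h (coset_pt K k g) = coset_pt K k (h * g).
Proof.
apply/esym/(eq_coset_pt K_subgroup); rewrite invgM -mulgA mulKg.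
exact: (coset_pt_repr K_subgroup k g).
Qed.

Lemma coset_qE j (k : A j) g : coset_q (coset_pt K k g) = lambda g (x j).
Proof.
rewrite /coset_q /=; have /= := coset_pt_repr K_subgroup k g.
by set h := repr_coset _ => Kh; rewrite -{1}[h](mulVKg g) lambdaM (K_stab Kh).
Qed.

Lemma coset_map_action :
  coset_map (K := K) x = action_map coset_act coset_q.
Proof.
apply/funext => -[y1 y2].
have [j1 [k1 [g1 ->]]] := coset_ptP y1.
have [j2 [k2 [g2 ->]]] := coset_ptP y2.
by rewrite coset_mapE // /action_map /= !(coset_qE, coset_actE).
Qed.

Lemma coset_equivariant : equivariant_action coset_act coset_q.
Proof.
split=> [y|g h y|g y].
- by have [j [k [g ->]]] := coset_ptP y; rewrite coset_actE mul1g.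
- by have [j [k [u ->]]] := coset_ptP y; rewrite !coset_actE mulgA.
- by have [j [k [u ->]]] := coset_ptP y; rewrite coset_actE !coset_qE lambdaM.
Qed.

Lemma subgroup1 j (k : A j) : K k 1.
Proof. by have [K1 _] := K_subgroup k; exact: set_mem K1. Qed.

Lemma coset_pt_tag j j' (k : A j) (k' : A j') g g' :
  coset_pt K k g = coset_pt K k' g' -> j = j'.
Proof. exact: (f_equal (@projT1 _ _)). Qed.

Lemma coset_pt_inj j (k k' : A j) g g' :
  coset_pt K k g = coset_pt K k' g' -> k = k'.
Proof. by move=> e; have [] := f_equal (@projT1 _ _) (existT_inj2 e). Qed.

Lemma coset_pt_eqP j (k : A j) g g' :
  coset_pt K k g = coset_pt K k g' <-> K k (g^-1 * g').
Proof.
split; last exact: eq_coset_pt.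
move=> e.
have /seteqP[_ /(_ g')] : left_coset g (K k) = left_coset g' (K k).
  have e' := existT_inj2 (existT_inj2 e).
  exact: (f_equal val e').
case; first by exists 1; rewrite ?mulg1 //; apply: subgroup1.
by move=> u Ku <-; rewrite mulKg.
Qed.

(** Fixing the coset hK means lying in the conjugate of K by h, so an element acting trivially lies
    in every core. *)
Lemma coset_faithful :
  \bigcap_(i in [set: J]) \bigcap_(k in [set: A i]) core (K k) = [set 1] ->
  faithful_action coset_act.
Proof.
move=> Kcore g gid; suff : [set 1] g by [].
rewrite -Kcore => j _ k _ h _; exists (h^-1 * g * h).
  have /esym := gid (coset_pt K k h); rewrite coset_actE => /coset_pt_eqP.
  by rewrite mulgA.
by rewrite !mulgA mulgV mul1g mulgK.
Qed.

(** Since each [A j] is inhabited, every orbit occurs among the values of [coset_q]. *)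
Lemma coset_generates :
  (forall j, inhabited (A j)) ->
  add_generates (\bigcup_(j in [set: J]) lambda_orbit (x j)) ->
  add_generates (range coset_q).
Proof.
move=> A0; congr add_generates; apply/seteqP; split=> [_ [j _ [g _ <-]]|].
  have [k] := A0 j; exists (coset_pt K k g) => //; exact: coset_qE.
move=> _ [y _ <-]; have [j [k [g ->]]] := coset_ptP y.
by exists j => //; exists g => //; rewrite coset_qE.
Qed.

End CosetAction.

(** * Isomorphisms of coset solutions and brace data, in both directions *)

Section CosetIsomorphisms.
Variable G : leftBraceType.
Variables (I : Type) (A : I -> Type) (x : I -> G) (K : forall i, A i -> set G).
Variables (J : Type) (B : J -> Type) (y : J -> G) (L : forall j, B j -> set G).
Hypothesis hK : forall i (k : A i), is_subgroup (K k).
Hypothesis hL : forall j (l : B j), is_subgroup (L l).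
Hypothesis hKst : forall i (k : A i), K k `<=` lambda_stab (x i).
Hypothesis hLst : forall j (l : B j), L l `<=` lambda_stab (y j).
Hypothesis x_orbits : forall i i' g, lambda g (x i) = x i' -> i = i'.
Hypothesis y_orbits : forall j j' g, lambda g (y j) = y j' -> j = j'.

Lemma brace_automorphism_lambda (psi : G -> G) g a :
  brace_automorphism psi -> psi (lambda g a) = lambda (psi g) (psi a).
Proof.
by case=> psiD psiM _; apply: (addrI (psi g)); rewrite -psiD -!lambdaE psiM.
Qed.

(** All data are read off the images of base points: the outer tag gives [alpha], the inner tag
    [beta], and a representative gives [z]. *)
Lemma coset_isomorphic_data :
  (forall i, inhabited (A i)) -> (forall j, inhabited (B j)) ->
  add_generates (\bigcup_(i in [set: I]) lambda_orbit (x i)) ->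
  add_generates (\bigcup_(j in [set: J]) lambda_orbit (y j)) ->
  \bigcap_(i in [set: I]) \bigcap_(k in [set: A i]) core (K k) = [set 1] ->
  \bigcap_(j in [set: J]) \bigcap_(l in [set: B j]) core (L l) = [set 1] ->
  solutions_isomorphic (coset_solution hK hKst) (coset_solution hL hLst) ->
  exists (psi : G -> G) (alpha : I -> J)
         (beta : forall i, A i -> B (alpha i)) (z : forall i, A i -> G),
    [/\ brace_automorphism psi,
        bijective alpha,
        forall i, bijective (beta i)
      & forall i (k : A i),
          psi (x i) = lambda (z i k) (y (alpha i)) /\
          psi @` K k = conj_set (z i k) (L (beta i k))].
Proof.
move=> A0 B0 gx gy Kcore Lcore [F bijF FE].
have [F' FK F'K] := bijF.
have qK := coset_qE hK hKst; have qL := coset_qE hL hLst.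
have actK := coset_actE hK; have actL := coset_actE hL.
have [psi [psi_auto psi_act psi_q]] : exists psi : G -> G,
    [/\ brace_automorphism psi,
        forall g w, F (coset_act g w) = coset_act (psi g) (F w)
      & forall w, psi (coset_q x w) = coset_q y (F w)].
  apply: (action_isomorphism (coset_equivariant hK hKst)
            (coset_equivariant hL hLst)) => //.
  - exact: coset_generates.
  - exact: coset_generates.
  - exact: coset_faithful.
  - exact: coset_faithful.
  - move=> p; rewrite -(coset_map_action hK hKst) -(coset_map_action hL hLst).
    exact: FE.
have [_ psiM [psi' psiK psi'K]] := psi_auto.
have psi_lambda g a := brace_automorphism_lambda g a psi_auto.
have data i (k : A i) : exists j (l : B j) z,
    [/\ F (coset_pt K k 1) = coset_pt L l z & psi (x i) = lambda z (y j)].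
  have [j [l [z Fk]]] := coset_ptP (F (coset_pt K k 1)).
  exists j, l, z; split=> //.
  by rewrite -(qL j l) -Fk -psi_q qK lambda1.
have /boolp.choice[alpha alphaP] i :
    exists j, forall k : A i, exists lz : B j * G,
    F (coset_pt K k 1) = coset_pt L lz.1 lz.2 /\ psi (x i) = lambda lz.2 (y j).
  (* Any [k0] determines [j]: [psi (x i)] meets the orbit of only one [y j], so the outer tag is the
     same for all [k]. *)
  have [k0] := A0 i; have [j [_ [z0 [_ xi0]]]] := data i k0.
  exists j => k; have [j' [l [z [Fk xi]]]] := data i k.
  have jj' : j' = j.
    by apply: (@y_orbits _ _ (z0^-1 * z)); rewrite lambdaM -xi xi0 lambdaK.
  by subst j'; exists (l, z).
have [lz lzP] : exists lz : forall i, A i -> B (alpha i) * G, forall i k,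
    F (coset_pt K k 1) = coset_pt L (lz i k).1 (lz i k).2 /\
    psi (x i) = lambda (lz i k).2 (y (alpha i)).
  exists (fun i k => projT1 (cid (alphaP i k))) => i k.
  exact: projT2 (cid (alphaP i k)).
have FK1 i (k : A i) : F (coset_pt K k 1) = coset_pt L (lz i k).1 (lz i k).2.
  by have [] := lzP i k.
have psi_x i (k : A i) : psi (x i) = lambda (lz i k).2 (y (alpha i)).
  by have [] := lzP i k.
have FE' i (k : A i) g :
    F (coset_pt K k g) = coset_pt L (lz i k).1 (psi g * (lz i k).2).
  by rewrite -[g in LHS]mulg1 -actK psi_act FK1 actL.
have F_onto j (l : B j) : exists i (k : A i) g,
    coset_pt L (lz i k).1 (psi g * (lz i k).2) = coset_pt L l 1.
  have [i [k [g Fk]]] := coset_ptP (F' (coset_pt L l 1)).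
  by exists i, k, g; rewrite -FE' -Fk F'K.
have alpha_inj i i' : alpha i = alpha i' -> i = i'.
  move=> ii'; have [k] := A0 i; have [k'] := A0 i'.
  (* This [g] carries [x i] to [x i'], since their images under [psi] lie in the orbit of the same
     [y]. *)
  pose g := psi' ((lz i' k').2 * (lz i k).2^-1).
  apply: (@x_orbits _ _ g); apply: (can_inj psiK).
  by rewrite psi_lambda psi'K (psi_x i k) (psi_x i' k') lambdaM lambdaK ii'.
exists psi, alpha, (fun i k => (lz i k).1), (fun i k => (lz i k).2).
split=> //.
- have /boolp.choice[alpha' alpha'P] j : exists i, alpha i = j.
    have [l] := B0 j; have [i [k [g e]]] := F_onto j l.
    by exists i; apply: coset_pt_tag e.
  by exists alpha' => // i; apply: alpha_inj; rewrite alpha'P.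
- move=> i; have beta_inj k k' : (lz i k).1 = (lz i k').1 -> k = k'.
    (* With this [g], the coset of [g] for [k] and the base point for [k'] have the same image under
       [F]. *)
    move=> kk'; pose g := psi' ((lz i k').2 * (lz i k).2^-1).
    apply: (@coset_pt_inj _ _ _ K _ _ _ g 1); apply: (can_inj FK).
    by rewrite FE' FK1 psi'K kk' mulgVK.
  have /boolp.choice[beta' beta'P] l : exists k, (lz i k).1 = l.
    have [i' [k [g e]]] := F_onto _ l.
    have ii' := alpha_inj _ _ (coset_pt_tag e); subst i'.
    by exists k; apply: coset_pt_inj e.
  by exists beta' => // k; apply: beta_inj; rewrite beta'P.
- move=> i k; split=> //.
  (* Stabilizers are compared: [g] fixes the base point exactly when [psi g] fixes its image. *)
  have KL g : K k g <-> L (lz i k).1 ((lz i k).2^-1 * (psi g * (lz i k).2)).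
    have := coset_pt_eqP hK k 1 g; have := coset_pt_eqP hL (lz i k).1
      (lz i k).2 (psi g * (lz i k).2).
    rewrite -FK1 -FE' invg1 mul1g => <- <-.
    by split=> [-> //|/(can_inj FK)].
  apply/seteqP; split=> [_ [g /KL Lg <-]|_ [u Lu <-]].
    by eexists; first exact: Lg; rewrite !mulgA mulgV mul1g mulgK.
  exists (psi' ((lz i k).2 * u * (lz i k).2^-1)); last by rewrite psi'K.
  by apply/KL; rewrite psi'K mulgVK mulKg.
Qed.

(** The conjugation condition makes the map on cosets well defined and injective; the condition on
    [psi (x i)] makes it compatible with [coset_q]. *)
Lemma coset_isomorphism (psi : G -> G) (alpha : I -> J)
    (beta : forall i, A i -> B (alpha i)) (z : forall i, A i -> G) :
  brace_automorphism psi -> bijective alpha ->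
  (forall i, bijective (beta i)) ->
  (forall i (k : A i), psi (x i) = lambda (z i k) (y (alpha i)) /\
     psi @` K k = conj_set (z i k) (L (beta i k))) ->
  solutions_isomorphic (coset_solution hK hKst) (coset_solution hL hLst).
Proof.
move=> psi_auto bij_alpha bij_beta data.
have psi_lambda g a := brace_automorphism_lambda g a psi_auto.
have [_ psiM bij_psi] := psi_auto; have psi_inj := bij_inj bij_psi.
have psi1 : psi 1 = 1 by apply: (mulgI (psi 1)); rewrite -psiM !mulg1.
have psiV g : psi g^-1 = (psi g)^-1.
  by apply: (mulgI (psi g)); rewrite -psiM !mulgV.
(* Left to right gives independence of the representative, right to left gives injectivity. *)
have KL i (k : A i) g : K k g <-> L (beta i k) ((z i k)^-1 * psi g * z i k).
  have [_ /seteqP[KsubL LsubK]] := data i k; split=> [Kg|Lg].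
    have [u Lu <-] := KsubL (psi g) (imageP psi Kg).
    by rewrite !mulgA mulVg mul1g mulgVK.
  suff /LsubK[h Kh /psi_inj <-] : conj_set (z i k) (L (beta i k)) (psi g) by [].
  by eexists; first exact: Lg; rewrite !mulgA mulgV mul1g mulgK.
pose F (w : coset_union K) : coset_union L :=
  let: existT i (existT k C) := w in
  coset_pt L (beta i k) (psi (repr_coset C) * z i k).
have FE i (k : A i) g :
    F (coset_pt K k g) = coset_pt L (beta i k) (psi g * z i k).
  apply/esym/(eq_coset_pt hL); rewrite invgM !mulgA -(mulgA _ (psi g)^-1).
  by rewrite -psiV -psiM; apply/KL/(coset_pt_repr hK k g).
have qK := coset_qE hK hKst; have qL := coset_qE hL hLst.
have actK := coset_actE hK; have actL := coset_actE hL.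
clearbody F; exists F => [|[w1 w2]].
(* Surjectivity yields a right inverse [F']; injectivity, checked on [w] and [F' (F w)], makes it
   two-sided. *)
- suff /boolp.choice[F' F'K] v : exists w, F w = v.
    exists F' => // w; move: (F'K (F w)).
    have [i [k [g ->]]] := coset_ptP w.
    have [i' [k' [g' ->]]] := coset_ptP (F' (F (coset_pt K k g))).
    rewrite !FE => e.
    have ii' := bij_inj bij_alpha (coset_pt_tag e); subst i'.
    have kk' := bij_inj (bij_beta i) (coset_pt_inj e); subst k'.
    apply/(coset_pt_eqP hK)/KL; move/(coset_pt_eqP hL): e.
    by rewrite psiM psiV invgM !mulgA.
  have [j [l [g ->]]] := coset_ptP v.
  have [alpha' _ alpha'K] := bij_alpha; have := alpha'K j.
  move: (alpha' j) => i ij; subst j.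
  have [beta' _ beta'K] := bij_beta i; have [psi' _ psi'K] := bij_psi.
  (* The inverse factor cancels the right translation by [z] built into [F]. *)
  exists (coset_pt K (beta' l) (psi' (g * (z i (beta' l))^-1))).
  by rewrite FE psi'K mulgVK beta'K.
- change (coset_map y (pair_map F (w1, w2)) =
          pair_map F (coset_map x (w1, w2))).
  rewrite (coset_map_action hK hKst) (coset_map_action hL hLst).
  (* Compatibility with the actions and with [coset_q] suffices, as [action_map] is built from these
     alone. *)
  have Fact g w : F (coset_act g w) = coset_act (psi g) (F w).
    by have [i [k [h ->]]] := coset_ptP w; rewrite actK !FE actL psiM mulgA.
  have Fq w : coset_q y (F w) = psi (coset_q x w).
    have [i [k [h ->]]] := coset_ptP w; have [xi _] := data i k.
    by rewrite FE qL qK lambdaM -xi psi_lambda.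
  by rewrite /action_map /pair_map /= !Fq -Fact Fq -psiV -Fact.
Qed.

End CosetIsomorphisms.

(** * Orbits and the reduction to families indexed by subtypes *)

Lemma lambda_orbit_eq (G : leftBraceType) (a b : G) :
  lambda_orbit a b -> lambda_orbit b = lambda_orbit a.
Proof.
case=> g _ <-; apply/seteqP; split=> _ [h _ <-].
  by exists (h * g); rewrite ?lambdaM.
by exists (h * g^-1); rewrite // lambdaM lambdaK.
Qed.

Theorem theorem4p1 (G : leftBraceType)
    (I : Type) (orb : I -> set G) (x : I -> G)
    (horb : set_bij [set: I] (range (@lambda_orbit G)) orb)
    (hx : forall i : I, orb i (x i))
    (I1 I2 : set I)
    (hI1 : add_generates (\bigcup_(i in I1) orb i))
    (hI2 : add_generates (\bigcup_(j in I2) orb j))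
    (A : I1 -> Type) (K : forall i : I1, A i -> set G)
    (hA : forall i : I1, inhabited (A i))
    (hK : forall (i : I1) (k : A i), is_subgroup (K i k))
    (hKst : forall (i : I1) (k : A i), K i k `<=` lambda_stab (x (val i)))
    (hKcore : \bigcap_(i in [set: I1]) \bigcap_(k in [set: A i]) core (K i k)
              = [set 1])
    (B : I2 -> Type) (L : forall j : I2, B j -> set G)
    (hB : forall j : I2, inhabited (B j))
    (hL : forall (j : I2) (l : B j), is_subgroup (L j l))
    (hLst : forall (j : I2) (l : B j), L j l `<=` lambda_stab (x (val j)))
    (hLcore : \bigcap_(j in [set: I2]) \bigcap_(l in [set: B j]) core (L j l)
              = [set 1]) :
  solutions_isomorphic (coset_solution hK hKst) (coset_solution hL hLst)
  <->
  exists (psi : G -> G) (alpha : I1 -> I2)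
         (beta : forall i : I1, A i -> B (alpha i))
         (z : forall i : I1, A i -> G),
    [/\ brace_automorphism psi,
        bijective alpha,
        forall i : I1, bijective (beta i)
      & forall (i : I1) (k : A i),
          psi (x (val i)) = lambda (z i k) (x (val (alpha i))) /\
          psi @` K i k = conj_set (z i k) (L (alpha i) (beta i k))].
Proof.
have orbE i : orb i = lambda_orbit (x i).
  have [orb_fun _ _] := horb; have [a _ aE] := orb_fun i Logic.I.
  by rewrite -aE; apply/esym/lambda_orbit_eq; rewrite aE.
(* Injectivity of [orb] turns a common orbit into equal indices. *)
have x_orbits i i' g : lambda g (x i) = x i' -> i = i'.
  move=> xi; have [_ orb_inj _] := horb.
  apply: orb_inj; rewrite ?inE // !orbE; apply/esym/lambda_orbit_eq.
  by exists g.
have gen (S : set I) : add_generates (\bigcup_(i in S) orb i) ->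
    add_generates (\bigcup_(i in [set: S]) lambda_orbit (x (val i))).
  congr add_generates; apply/seteqP; split=> [g [i Si]|g [i _ gi]].
    by rewrite orbE => gi; exists (exist _ i (mem_set Si)).
  by exists (val i); [exact: (set_mem (valP i))|rewrite orbE].
have val_orbits (S : set I) (i i' : S) g :
    lambda g (x (val i)) = x (val i') -> i = i'.
  by move/x_orbits/val_inj.
split.
  apply: coset_isomorphic_data => //; try exact: val_orbits; exact: gen.
case=> psi [alpha [beta [z [psi_auto bij_alpha bij_beta data]]]].
exact: (coset_isomorphism _ _ _ _ psi_auto bij_alpha bij_beta data).
Qed.
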